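(* Let $g:\mathbb{R}^m\to\mathbb{R}$ be a Fréchet differentiable function whose gradient is $L_g$-Lipschitz continuous, let $\alpha>0$, $\beta\in(0,1)$, $0<s<\frac{2(1-\beta)}{L_g}$, let $x_0,x_{-1}\in\mathbb{R}^m$, and let $(x_n)_{n\in\mathbb{N}},(y_n)_{n\in\mathbb{N}}$ be generated, for all $n\in\mathbb{N}$, by $$y_n=x_n+\frac{\beta n}{n+\alpha}(x_n-x_{n-1}),\qquad x_{n+1}=y_n-s\nabla g(y_n).$$ Assume that $g$ is strongly convex and let $x^*$ be the unique minimizer of $g$. Then there exist $Q\in[0,1)$, $a_1,a_2,a_3,a_4>0$ and $\overline{k}\in\mathbb{N}$ such that for every $n\ge\overline{k}$: (a$_1$) $g(y_n)-g(x^* )\le a_1Q^n$; (a$_2$) $g(x_n)-g(x^* )\le a_2Q^n$; (a$_3$) $\|x_n-x^*\|\le a_3Q^{\frac n2}$; (a$_4$) $\|y_n-x^*\|\le a_4Q^{\frac n2}$.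
   Context: $\mathbb{N}=\{0,1,2,\dots\}$; $\|\cdot\|$ is the Euclidean norm. $L_g$-Lipschitz gradient means: $L_g\ge 0$ and $\|\nabla g(x)-\nabla g(y)\|\le L_g\|x-y\|$ for all $x,y\in\mathbb{R}^m$. *)

(* Defs.v *)
From HB Require Import structures.
From mathcomp Require Import all_boot all_order all_algebra.
From mathcomp Require Import all_classical all_reals all_analysis.
Set Implicit Arguments.
Unset Strict Implicit.
Unset Printing Implicit Defensive.
Import Order.TTheory GRing.Theory Num.Theory.
Import numFieldNormedType.Exports.
Local Open Scope ring_scope.

(* The library norm `|v| on 'rV[R]_m is the sup norm, so the Euclidean norm is
   defined here. [differentiable] does not depend on this choice, the two norms
   being equivalent. *)
Definition enorm (R : realType) (m : nat) (v : 'rV[R]_m) : R :=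
  Num.sqrt (\sum_(j < m) v 0 j ^+ 2).

Definition gradient (R : realType) (m : nat) (g : 'rV[R]_m -> R^o)
    (x : 'rV[R]_m) : 'rV[R]_m :=
  \row_(j < m) 'd g x (delta_mx 0 j).

Lemma gradientE (R : realType) (m : nat) (g : 'rV[R]_m -> R^o)
    (x h : 'rV[R]_m) :
  'd g x h = \sum_(j < m) gradient g x 0 j * h 0 j.
Proof.
rewrite [in LHS](row_sum_delta h) linear_sum; apply: eq_bigr => j _.
by rewrite mxE linearZ [RHS]mulrC.
Qed.

Definition lipschitz_gradient (R : realType) (m : nat) (L : R)
    (g : 'rV[R]_m -> R^o) : Prop :=
  0 <= L /\
  forall x y : 'rV[R]_m,
    enorm (gradient g x - gradient g y) <= L * enorm (x - y).

Definition strongly_convex (R : realType) (m : nat) (g : 'rV[R]_m -> R^o)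
    : Prop :=
  exists2 mu : R, 0 < mu &
    forall (x y : 'rV[R]_m) (t : R), 0 <= t <= 1 ->
      g (t *: x + (1 - t) *: y) <=
        t * g x + (1 - t) * g y - mu / 2 * t * (1 - t) * enorm (x - y) ^+ 2.

Definition minimizer (R : realType) (m : nat) (g : 'rV[R]_m -> R^o)
    (z : 'rV[R]_m) : Prop :=
  forall x : 'rV[R]_m, g z <= g x.

(* [shifted um1 u n] is the term of index n - 1 of u, um1 being that of index -1. *)
Definition shifted (T : Type) (um1 : T) (u : nat -> T) (n : nat) : T :=
  if n is k.+1 then u k else um1.

(* Main.v *)
(** Write d_n = x_n - x_(n-1), tau = s L / 2 < 1 - beta, and consider the energy
    E_n = g(y_n) - g(x^* ) + (delta / s) |d_n|^2. The descent lemma between y_n and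
    y_(n+1), with s grad g(y_n) = b_n d_n - d_(n+1) and
    y_(n+1) - y_n = (1 + b_(n+1)) d_(n+1) - b_n d_n, bounds E_(n+1) - E_n by a
    quadratic form in (d_n, d_(n+1)). For delta well chosen this form is negative
    definite at b_n = b_(n+1) = beta exactly because tau < 1 - beta, hence
    E_(n+1) <= E_n - c (|d_n|^2 + |d_(n+1)|^2) once b_n is close to beta. By the
    Polyak-Lojasiewicz inequality g(y_n) - g(x^* ) is at most a multiple of
    |grad g(y_n)|^2, so E_n <= K (|d_n|^2 + |d_(n+1)|^2), and therefore
    E_(n+1) <= (K / (K + c)) E_n. The bound on g(x_(n+1)) follows since a gradient
    step decreases g, and the bounds on distances from quadratic growth. *)
Require Import Defs.
From HB Require Import structures.
From mathcomp Require Import all_boot all_order all_algebra.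
From mathcomp Require Import ring lra.
From mathcomp Require Import all_classical all_reals all_analysis.
Set Implicit Arguments.
Unset Strict Implicit.
Import Order.TTheory GRing.Theory Num.Theory.
Import numFieldNormedType.Exports.
Local Open Scope ring_scope.

(** * Derivative bounds on the unit interval and along lines *)

(** Subtracting the primitive [a * t + c / 2 * t ^+ 2] leaves a function with nonpositive derivative
    on the open interval; this yields the factor 1/2 without integration. *)
Lemma increment_le_of_derive_le (R : realType) (f df : R -> R) (a c : R) :
  (forall t : R, is_derive t 1 f (df t)) ->
  (forall t : R, 0 < t < 1 -> df t <= a + c * t) ->
  f 1 - f 0 <= a + c / 2.
Proof.
move=> fE df_le.
pose F (t : R) : R := f t - (a * t + c / 2 * t ^+ 2).
have FE (t : R) : is_derive t 1 F (df t - (a + c * t)).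
  rewrite /F; apply: is_derive_eq.
  rewrite /GRing.scale /= ; lra.
have F01 : F 1 <= F 0.
  apply: (@ler0_derive1_le_cc _ F 0 1) => //.
  - move=> t /[!in_itv] /= t01; rewrite derive1E (@derive_val _ _ _ _ _ _ _ (FE t)) subr_le0.
    exact: df_le.
  - apply: derivable_within_continuous => t _; by case: (FE t).
  - by rewrite in_itv /= lexx ler01.
  - by rewrite in_itv /= lexx ler01.
by move: F01; rewrite /F; lra.
Qed.

Lemma increment_bound (R : realType) (f df : R -> R) (a c : R) :
  (forall t : R, is_derive t 1 f (df t)) ->
  (forall t : R, 0 < t < 1 -> `|df t - a| <= c * t) ->
  `|f 1 - f 0 - a| <= c / 2.
Proof.
move=> fE df_le.
have up : f 1 - f 0 <= a + c / 2.
  apply: increment_le_of_derive_le fE _ => t /df_le.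
  by rewrite ler_norml => /andP[]; lra.
have low : (- f) 1 - (- f) 0 <= - a + c / 2.
  apply: (@increment_le_of_derive_le R (- f) (fun t => - df t)) => t /df_le.
  by rewrite ler_norml => /andP[]; lra.
have {}low : - f 1 - - f 0 <= - a + c / 2 by [].
by rewrite ler_norml; apply/andP; split; lra.
Qed.

Lemma is_derive_line (R : realType) (m : nat) (g : 'rV[R]_m -> R^o)
    (z h : 'rV[R]_m) (t : R) :
  differentiable g (z + t *: h) ->
  is_derive t 1 (fun u : R => g (z + u *: h)) ('d g (z + t *: h) h).
Proof.
move=> dg.
have dl : is_diff t (fun u : R => z + u *: h) (fun u : R => u *: h).
  have := is_diffD (is_diff_cst z t) (is_diff_scalel t h).
  by rewrite add0r.
have dc := differentiable_comp (@ex_diff _ _ _ _ _ _ _ dl) dg.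
split; first exact/derivable1_diffP.
rewrite deriveE // -/(g \o (fun u => z + u *: h)) diff_comp //=.
by rewrite diff_val scale1r.
Qed.

(** * Inner product and the descent lemma *)

Definition dot (R : realType) (m : nat) (u v : 'rV[R]_m) : R :=
  \sum_(j < m) u 0 j * v 0 j.

Lemma dot_ge0 (R : realType) (m : nat) (v : 'rV[R]_m) : 0 <= dot v v.
Proof. by apply: sumr_ge0 => j _; rewrite -expr2 sqr_ge0. Qed.

Lemma enorm_ge0 (R : realType) (m : nat) (v : 'rV[R]_m) : 0 <= enorm v.
Proof. exact: sqrtr_ge0. Qed.

Lemma enorm_sqr (R : realType) (m : nat) (v : 'rV[R]_m) :
  enorm v ^+ 2 = dot v v.
Proof.
rewrite /enorm sqr_sqrtr; last by apply: sumr_ge0 => j _; apply: sqr_ge0.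
by apply: eq_bigr => j _; rewrite expr2.
Qed.

Lemma dotZ (R : realType) (m : nat) (a b : R) (u v : 'rV[R]_m) :
  dot (a *: u) (b *: v) = a * b * dot u v.
Proof. by rewrite /dot big_distrr; apply: eq_bigr => j _; rewrite !mxE /=; ring. Qed.

Lemma dotBl (R : realType) (m : nat) (u v w : 'rV[R]_m) :
  dot (u - v) w = dot u w - dot v w.
Proof.
by rewrite /dot -sumrB; apply: eq_bigr => j _; rewrite !mxE mulrBl.
Qed.

(** Takes the place of Cauchy-Schwarz, with the weight [k] tuned at each use. Each coordinate
    contributes a square divided by [k]. *)
Lemma young_dot (R : realType) (m : nat) (k : R) (u v : 'rV[R]_m) :
  0 < k -> 2 * `|dot u v| <= dot u u / k + k * dot v v.
Proof.
move=> k_gt0.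
(* [e] stands for the sign of [dot u v], so one expansion serves both cases of the absolute
   value. *)
have young (e : R) : e ^+ 2 = 1 -> 2 * (e * dot u v) <= dot u u / k + k * dot v v.
  move=> e2; rewrite /dot !big_distrr mulr_suml -big_split /=.
  apply: ler_sum => j _.
  have : 0 <= (e * u 0 j - k * v 0 j) ^+ 2 / k.
    by rewrite divr_ge0 ?sqr_ge0// ltW.
  rewrite sqrrB !exprMn e2.
  have -> : (1 * u 0 j ^+ 2 - e * u 0 j * (k * v 0 j) *+ 2 +
      k ^+ 2 * v 0 j ^+ 2) / k =
      u 0 j * u 0 j / k - 2 * (e * (u 0 j * v 0 j)) + k * (v 0 j * v 0 j).
    by field; rewrite gt_eqF.
  by lra.
by case: (ger0P (dot u v)) => _;
  [rewrite -[dot u v]mul1r|rewrite -mulN1r]; apply: young; ring.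
Qed.

(** Two-sided descent lemma: along the segment, the derivative drifts from its initial value by at
    most [L * dot h h * t]. *)
Lemma lipschitz_gradient_quadratic (R : realType) (m : nat)
    (g : 'rV[R]_m -> R^o) (L : R) :
  (forall z, differentiable g z) -> 0 < L -> lipschitz_gradient L g ->
  forall z h : 'rV[R]_m,
    `|g (z + h) - g z - dot (gradient g z) h| <= L / 2 * dot h h.
Proof.
move=> dg L_gt0 [_ lip] z h.
pose f (t : R) : R := g (z + t *: h).
have fE (t : R) : is_derive t 1 f (dot (gradient g (z + t *: h)) h).
  by rewrite /dot -gradientE; apply: is_derive_line.
have f1 : f 1 = g (z + h) by rewrite /f scale1r.
have f0 : f 0 = g z by rewrite /f scale0r addr0.
have var (t : R) : 0 < t < 1 ->
    `|dot (gradient g (z + t *: h)) h - dot (gradient g z) h|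
      <= L * dot h h * t.
  move=> /andP[t_gt0 _]; rewrite -dotBl.
  set u := _ - _.
  (* With weight [L * t] both terms of Young's inequality are at most [L * t * dot h h], so nothing
     is lost against Cauchy-Schwarz. *)
  have k_gt0 : 0 < L * t by rewrite mulr_gt0.
  have uu : dot u u <= (L * t) ^+ 2 * dot h h.
    have := lip (z + t *: h) z.
    rewrite -/u addrAC subrr add0r => u_le.
    have : enorm u ^+ 2 <= (L * enorm (t *: h)) ^+ 2.
      by rewrite ler_sqr // nnegrE ?mulr_ge0 ?enorm_ge0 // ltW.
    rewrite exprMn !enorm_sqr dotZ => /le_trans-> //.
    by rewrite le_eqVlt; apply/orP; left; apply/eqP; ring.
  have := young_dot u h k_gt0.
  have : dot u u / (L * t) <= L * t * dot h h.
    rewrite ler_pdivrMr// (le_trans uu)//.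
    by rewrite le_eqVlt; apply/orP; left; apply/eqP; ring.
  by lra.
rewrite -f1 -f0 [L / 2 * _]mulrAC.
exact: increment_bound fE var.
Qed.

(** * Consequences of strong convexity *)

(** Exposes the modulus that [strongly_convex] quantifies away, so that all estimates share one
    [mu]. *)
Definition strongly_convex_with (R : realType) (m : nat) (mu : R)
    (g : 'rV[R]_m -> R^o) : Prop :=
  forall (x y : 'rV[R]_m) (t : R), 0 <= t <= 1 ->
    g (t *: x + (1 - t) *: y) <=
      t * g x + (1 - t) * g y - mu / 2 * t * (1 - t) * enorm (x - y) ^+ 2.

(** Convexity is used only at the midpoint of [z] and [xs], where [g] is at least [g xs]; hence
    [mu / 4]. *)
Lemma quadratic_growth (R : realType) (m : nat) (g : 'rV[R]_m -> R^o)
    (mu : R) (xs z : 'rV[R]_m) :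
  strongly_convex_with mu g -> minimizer g xs ->
  mu / 4 * dot (z - xs) (z - xs) <= g z - g xs.
Proof.
move=> sc xs_min.
have half01 : 0 <= (2^-1 : R) <= 1 by apply/andP; split; lra.
have := sc z xs 2^-1 half01.
have := xs_min (2^-1 *: z + (1 - 2^-1) *: xs).
by rewrite enorm_sqr; lra.
Qed.

(* The lower half of the descent lemma replaces the limit t -> 0 in the
   derivation of this inequality, at the price of mu / 4 instead of mu / 2. *)
Lemma strongly_convex_gradient (R : realType) (m : nat)
    (g : 'rV[R]_m -> R^o) (L mu : R) :
  (forall z, differentiable g z) -> 0 < L -> lipschitz_gradient L g ->
  0 < mu -> strongly_convex_with mu g ->
  forall z h : 'rV[R]_m,
    dot (gradient g z) h + mu / 4 * dot h h <= g (z + h) - g z.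
Proof.
move=> dg L_gt0 lip mu_gt0 sc z h.
(* With this [t] the second-order loss [t * (mu + L) / 2] equals [mu / 4], half of the gain
   [mu / 2]. *)
pose t : R := mu / (2 * (mu + L)).
have t_gt0 : 0 < t by rewrite divr_gt0 ?mulr_gt0 ?addr_gt0.
have tE : t * (mu + L) = mu / 2.
  by rewrite /t; field; rewrite gt_eqF ?addr_gt0.
have t_le1 : t <= 1 by rewrite ler_pdivrMr ?mulr_gt0 ?addr_gt0//; lra.
have t01 : 0 <= t <= 1 by rewrite ltW.
have := sc (z + h) z t t01.
have -> : t *: (z + h) + (1 - t) *: z = z + t *: h.
  by rewrite scalerDr scalerBl scale1r addrACA addrC addrA subrK addrC.
have -> : z + h - z = h by rewrite addrAC subrr add0r.
rewrite enorm_sqr => conv.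
have := lipschitz_gradient_quadratic dg L_gt0 lip z (t *: h).
rewrite dotZ -[X in dot X (t *: h)]scale1r dotZ mul1r => /ler_normlP[low _].
rewrite -(ler_pM2l t_gt0).
move: conv low; move: (dot (gradient g z) h) (dot h h) => G H.
move: (g (z + h)) (g (z + t *: h)) (g z) => a b c conv low.
have tt : t ^+ 2 * (mu + L) * H = t * (mu / 2) * H by rewrite -tE; ring.
lra.
Qed.

(** Young's inequality with weight [mu / 2] makes the quadratic term of the strong convexity bound
    absorb the part of [dot G h] that depends on [h]. *)
Lemma polyak_lojasiewicz (R : realType) (m : nat)
    (g : 'rV[R]_m -> R^o) (L mu : R) :
  (forall z, differentiable g z) -> 0 < L -> lipschitz_gradient L g ->
  0 < mu -> strongly_convex_with mu g ->
  forall z w : 'rV[R]_m,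
    g z - g w <= dot (gradient g z) (gradient g z) / mu.
Proof.
move=> dg L_gt0 lip mu_gt0 sc z w.
have := strongly_convex_gradient dg L_gt0 lip mu_gt0 sc z (w - z).
have -> : z + (w - z) = w by rewrite addrC subrK.
set G := gradient g z; set h := w - z.
have mu2_gt0 : 0 < mu / 2 by rewrite divr_gt0.
have := young_dot G h mu2_gt0.
have -> : dot G G / (mu / 2) = 2 * (dot G G / mu) by field; rewrite gt_eqF.
move: (dot G h) (dot h h) (dot G G / mu) => a b c.
by case: (ler0P a) => ?; lra.
Qed.

(** * Decrease of the energy along the iteration *)

(* At b = b' = beta the left-hand side equals
   delta d^2 - eps (d^2 + d'^2) - (C / 2) (d - d')^2, where
   C = beta (2 + beta - 2 tau (1 + beta)) >= 0 is the cross coefficient; this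
   fixes the choice of delta. Half of the slack eps absorbs the error made when
   b and b' are only close to beta. *)
Lemma inertial_quadratic_form (R : realFieldType) (beta tau eps delta b b' d d' : R) :
  0 < beta -> beta < 1 -> 0 < tau -> tau < 1 - beta ->
  eps = (1 - beta - tau) / 2 -> delta = beta * (1 - beta / 2 - tau) + eps ->
  beta - eps / 12 <= b <= beta -> beta - eps / 12 <= b' <= beta ->
  (b * d - d') * ((1 + b') * d' - b * d) + tau * ((1 + b') * d' - b * d) ^+ 2
    + delta * d' ^+ 2 <= delta * d ^+ 2 - eps / 2 * (d ^+ 2 + d' ^+ 2).
Proof.
move=> beta_gt0 beta_lt1 tau_gt0 tau_lt epsE deltaE /andP[b_ge b_le] /andP[b'_ge b'_le].
pose C : R := beta * (2 + beta - 2 * tau * (1 + beta)).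
have C_ge0 : 0 <= C by rewrite mulr_ge0 ?ltW//; nra.
have eps_gt0 : 0 < eps by lra.
have limit : (beta * d - d') * ((1 + beta) * d' - beta * d)
    + tau * ((1 + beta) * d' - beta * d) ^+ 2 + delta * d' ^+ 2
    = delta * d ^+ 2 - eps * (d ^+ 2 + d' ^+ 2) - C / 2 * (d - d') ^+ 2.
  by rewrite deltaE epsE /C; field.
have sq_ge0 : 0 <= C / 2 * (d - d') ^+ 2 by rewrite mulr_ge0 ?sqr_ge0 ?divr_ge0.
(* Changes in the coefficients of [d' ^+ 2], [d ^+ 2] and [d * d'] when [beta] is replaced by [b]
   and [b'], factored through [b - beta] and [b' - beta]. *)
pose A1 : R := (b' - beta) * (tau * (2 + b' + beta) - 1).
pose A2 : R := (b - beta) * (b + beta) * (tau - 1).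
pose A3 : R := (b - beta) * (2 + b' - 2 * tau * (1 + b')) + beta * (b' - beta) * (1 - 2 * tau).
have perturb : (b * d - d') * ((1 + b') * d' - b * d) + tau * ((1 + b') * d' - b * d) ^+ 2
    = (beta * d - d') * ((1 + beta) * d' - beta * d)
    + tau * ((1 + beta) * d' - beta * d) ^+ 2 + A1 * d' ^+ 2 + A2 * d ^+ 2 + A3 * (d * d').
  by rewrite /A1 /A2 /A3; ring.
have eps_le : eps <= 1 / 2 by lra.
have [c1 c2] : b' - beta <= 0 /\ - (eps / 12) <= b' - beta by lra.
have [c3 c4] : b - beta <= 0 /\ - (eps / 12) <= b - beta by lra.
have nb (u v K : R) : u <= 0 -> - (eps / 12) <= u -> - K <= v -> v <= K ->
    `|u * v| <= eps / 12 * K.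
  move=> u1 u2 v1 v2; rewrite normrM; apply: ler_pM => //.
    by rewrite ler_norml; lra.
  by rewrite ler_norml; apply/andP.
(* Splitting the cross term evenly, the errors total 11/2 and 9/2 times [eps / 12], below [eps / 2]:
   this is why the tolerance is [eps / 12]. *)
have A1_le : `|A1| <= eps / 12 * 3 by apply: nb => //; nra.
have A2_le : `|A2| <= eps / 12 * 2 by rewrite /A2 -mulrA; apply: nb => //; nra.
have A3_le : `|A3| <= eps / 12 * 5.
  have P1 : `|(b - beta) * (2 + b' - 2 * tau * (1 + b'))| <= eps / 12 * 4.
    by apply: nb => //; nra.
  have P2 : `|(b' - beta) * (beta * (1 - 2 * tau))| <= eps / 12 * 1.
    by apply: nb => //; nra.
  rewrite /A3 [beta * (b' - beta)]mulrC -[_ * beta * _]mulrA.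
  by rewrite (le_trans (ler_normD _ _))//; lra.
have T1 : A1 * d' ^+ 2 <= eps / 12 * 3 * d' ^+ 2.
  by rewrite ler_wpM2r ?sqr_ge0// (le_trans (ler_norm _)).
have T2 : A2 * d ^+ 2 <= eps / 12 * 2 * d ^+ 2.
  by rewrite ler_wpM2r ?sqr_ge0// (le_trans (ler_norm _)).
have T3 : A3 * (d * d') <= eps / 12 * 5 * ((d ^+ 2 + d' ^+ 2) / 2).
  rewrite (le_trans (ler_norm _))// normrM ler_pM//.
  have := sqr_ge0 (d - d'); have := sqr_ge0 (d + d').
  by rewrite ler_norml sqrrD sqrrB => ? ?; apply/andP; split; lra.
have := sqr_ge0 d; have := sqr_ge0 d' => sd' sd.
have S : 0 <= eps * d ^+ 2 /\ 0 <= eps * d' ^+ 2 by split; rewrite mulr_ge0 // ltW.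
rewrite perturb; lra.
Qed.

(** Multiplied by [s], the descent inequality from [y] to [y'] splits over coordinates, and each
    coordinate is an instance of [inertial_quadratic_form] with [tau = s * L / 2]. *)
Lemma energy_decrease (R : realType) (m : nat) (g : 'rV[R]_m -> R^o)
    (L s beta eps delta b b' : R) (u u' d y y' : 'rV[R]_m) :
  (forall z, differentiable g z) -> 0 < L -> lipschitz_gradient L g ->
  0 < beta -> beta < 1 -> 0 < s -> s * L / 2 < 1 - beta ->
  eps = (1 - beta - s * L / 2) / 2 ->
  delta = beta * (1 - beta / 2 - s * L / 2) + eps ->
  beta - eps / 12 <= b <= beta -> beta - eps / 12 <= b' <= beta ->
  y = u + b *: d -> u' = y - s *: gradient g y -> y' = u' + b' *: (u' - u) ->
  g y' + delta / s * dot (u' - u) (u' - u) <=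
    g y + delta / s * dot d d
    - eps / (2 * s) * (dot d d + dot (u' - u) (u' - u)).
Proof.
move=> dg L_gt0 lip beta_gt0 beta_lt1 s_gt0 tau_lt epsE deltaE b_in b'_in yE u'E y'E.
set d' := u' - u.
have := lipschitz_gradient_quadratic dg L_gt0 lip y (y' - y).
have -> : y + (y' - y) = y' by rewrite addrC subrK.
move=> /ler_normlP[_].
have sG j : s * gradient g y 0 j = b * d 0 j - d' 0 j.
  by rewrite /d' u'E {2}yE !mxE; ring.
have hE j : (y' - y) 0 j = (1 + b') * d' 0 j - b * d 0 j.
  by rewrite y'E {1}/d' yE /d' !mxE; ring.
have tau_gt0 : 0 < s * L / 2 by rewrite divr_gt0 ?mulr_gt0.
have quad : s * dot (gradient g y) (y' - y)
    + s * L / 2 * dot (y' - y) (y' - y) + delta * dot d' d'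
    <= delta * dot d d - eps / 2 * (dot d d + dot d' d').
  rewrite /dot -big_split !big_distrr -!big_split -sumrB /=.
  apply: ler_sum => j _; rewrite mulrA sG hE -!expr2.
  have := inertial_quadratic_form (d 0 j) (d' 0 j)
    beta_gt0 beta_lt1 tau_gt0 tau_lt epsE deltaE b_in b'_in.
  by move: (d 0 j) (d' 0 j) (s * L / 2) => p q tau; clear; lra.
have scale_s (a a' p p' : R) :
    s * a' + delta * p' <= s * a + delta * p - eps / 2 * (p + p') ->
    a' + delta / s * p' <= a + delta / s * p - eps / (2 * s) * (p + p').
  rewrite -(ler_pM2l s_gt0 (a' + _)).
  have -> : s * (a' + delta / s * p') = s * a' + delta * p'.
    by field; rewrite gt_eqF.
  have -> : s * (a + delta / s * p - eps / (2 * s) * (p + p'))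
      = s * a + delta * p - eps / 2 * (p + p').
    by field; rewrite gt_eqF.
  by [].
move=> descent; apply: scale_s.
have := descent; rewrite -(ler_pM2l s_gt0).
move: quad; clear.
move: (dot (gradient g y) _) (dot (y' - y) _) (dot d d) (dot d' d') => p q r r'.
by move: (g y') (g y) => a' a; lra.
Qed.

(** The descent lemma at [- s *: G] gives a drop of at least [s * (1 - s * L / 2) * dot G G]. *)
Lemma gradient_step_decrease (R : realType) (m : nat) (g : 'rV[R]_m -> R^o)
    (L s : R) (y : 'rV[R]_m) :
  (forall z, differentiable g z) -> 0 < L -> lipschitz_gradient L g ->
  0 < s -> s * L / 2 <= 1 -> g (y - s *: gradient g y) <= g y.
Proof.
move=> dg L_gt0 lip s_gt0 tau_le1; set G := gradient g y.
have := lipschitz_gradient_quadratic dg L_gt0 lip y (- s *: G).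
rewrite dotZ -/G -[X in dot X (- s *: G)]scale1r dotZ scaleNr.
move: (dot_ge0 G); move: (dot G G) (g (y - s *: G)) (g y) => D a b D_ge0.
move=> /ler_normlP[_ h].
have : 0 <= s * D * (1 - s * L / 2) by rewrite !mulr_ge0 ?subr_ge0// ltW.
by lra.
Qed.

(** Lets two consecutive displacements control the gradient, and through it the gap in values. *)
Lemma gradient_dot_le (R : realType) (m : nat) (s b : R) (G d d' : 'rV[R]_m) :
  0 <= b <= 1 -> s *: G = b *: d - d' ->
  s ^+ 2 * dot G G <= 2 * (dot d d + dot d' d').
Proof.
move=> /andP[b_ge0 b_le1] sG.
rewrite expr2 -dotZ sG /dot -big_split big_distrr /=.
apply: ler_sum => j _; rewrite !mxE -!expr2.
have := sqr_ge0 (b * d 0 j + d' 0 j).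
have : 0 <= (1 - b ^+ 2) * d 0 j ^+ 2.
  by rewrite mulr_ge0 ?sqr_ge0// subr_ge0 exprn_ile1.
by move: (d 0 j) (d' 0 j) => p q; lra.
Qed.

(** * From energy decrease to a geometric rate *)

Lemma geometric_decay (R : realFieldType) (E : nat -> R) (Q : R) (k : nat) :
  0 < Q -> (forall n, (k <= n)%N -> E n.+1 <= Q * E n) ->
  forall n, (k <= n)%N -> E n <= E k / Q ^+ k * Q ^+ n.
Proof.
move=> Q_gt0 E_dec n /subnK <-; elim: (n - k)%N => [|p IH].
  by rewrite add0n divfK // expf_neq0 // gt_eqF.
rewrite addSn (le_trans (E_dec _ (leq_addl _ _)))//.
by rewrite exprS mulrCA ler_pM2l.
Qed.

(** The factor [K / (K + c)] lies in (0, 1) however [c] and [K] compare, whereas [1 - c / K] could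
    be negative. *)
Lemma contraction_of_decrease (R : realFieldType) (E E' P c K : R) :
  0 < c -> 0 < K -> E' <= E - c * P -> 0 <= P -> E <= K * P ->
  E' <= K / (K + c) * E.
Proof.
move=> c_gt0 K_gt0 E'_le P_ge0 E_le.
have Kc_gt0 : 0 < K + c by rewrite addr_gt0.
rewrite mulrAC ler_pdivlMr//.
have : E' * (K + c) <= (E - c * P) * (K + c) by rewrite ler_pM2r.
have : c * E <= c * (K * P) by rewrite ler_pM2l.
have : 0 <= c * c * P by rewrite !mulr_ge0 // ltW.
lra.
Qed.

(** The gap to [beta] is [beta * alpha / (n + alpha)], at most [eta] once [n * eta >= alpha]. *)
Lemma inertial_coefficient_near (R : realType) (alpha beta eta : R) :
  0 < alpha -> 0 < beta -> beta < 1 -> 0 < eta ->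
  exists k : nat, forall n : nat, (k <= n)%N ->
    beta - eta <= beta * n%:R / (n%:R + alpha) <= beta.
Proof.
move=> alpha_gt0 beta_gt0 beta_lt1 eta_gt0.
exists (Num.bound (alpha / eta)) => n kn.
have na_gt0 : 0 < n%:R + alpha by rewrite ltr_wpDl.
have n_ge : alpha <= n%:R * eta.
  rewrite -ler_pdivrMr// ltW// (lt_le_trans (archi_boundP _)) ?ler_nat//.
  by rewrite divr_ge0 ?ltW.
rewrite ler_pdivlMr// ler_pdivrMr//.
have : 0 <= beta * alpha by rewrite mulr_ge0 ?ltW.
have : beta * alpha <= alpha by rewrite ger_pMl ?ltW.
have : 0 <= eta * alpha by rewrite mulr_ge0 ?ltW.
by move=> *; apply/andP; split; lra.
Qed.

(** If [Lg = 0], any positive number is also a Lipschitz constant; [(1 - beta) / s] makes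
    [s * L / 2] half of [1 - beta]. *)
Lemma positive_lipschitz_constant (R : realType) (m : nat)
    (g : 'rV[R]_m -> R^o) (Lg beta s : R) :
  lipschitz_gradient Lg g -> beta < 1 -> 0 < s ->
  (0 < Lg -> s < 2 * (1 - beta) / Lg) ->
  exists L : R, [/\ 0 < L, lipschitz_gradient L g & s * L / 2 < 1 - beta].
Proof.
move=> lip beta_lt1 s_gt0 s_lt; have [Lg_ge0 lipg] := lip.
have [Lg_gt0|Lg_le0] := ltP 0 Lg.
  exists Lg; split=> //.
  by have := s_lt Lg_gt0; rewrite ltr_pdivlMr// ltr_pdivrMr// [_ * 2]mulrC.
have b_gt0 : 0 < 1 - beta by rewrite subr_gt0.
exists ((1 - beta) / s); split; first by rewrite divr_gt0.
  split; first by rewrite ltW ?divr_gt0.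
  move=> z w; rewrite (le_trans (lipg z w))// ler_wpM2r ?enorm_ge0//.
  by rewrite (le_trans Lg_le0)// ltW ?divr_gt0.
have -> : s * ((1 - beta) / s) = 1 - beta by field; rewrite gt_eqF.
by lra.
Qed.

(** [Q] to the power [n / 2] is the square root of [Q ^+ n], so this is the square root of the
    hypothesis. *)
Lemma enorm_le_powR (R : realType) (m : nat) (v : 'rV[R]_m) (a mu Q : R) (n : nat) :
  0 < mu -> 0 < a -> 0 <= Q -> mu / 4 * dot v v <= a * Q ^+ n ->
  enorm v <= Num.sqrt (4 * a / mu) * Q `^ (n%:R / 2).
Proof.
move=> mu_gt0 a_gt0 Q_ge0 v_le.
rewrite powRrM powR_mulrn// powR12_sqrt ?exprn_ge0//.
have c_ge0 : 0 <= 4 * a / mu by rewrite divr_ge0 ?mulr_ge0 ?ltW.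
rewrite -sqrtrM// -(ger0_norm (enorm_ge0 v)) -sqrtr_sqr ler_wsqrtr// enorm_sqr.
have -> : 4 * a / mu * Q ^+ n = (a * Q ^+ n) / (mu / 4).
  by field; rewrite gt_eqF.
by rewrite ler_pdivlMr ?divr_gt0// mulrC.
Qed.

(** * Linear convergence of values and iterates *)

Lemma inertial_energy_geometric (R : realType) (m : nat)
    (g : 'rV[R]_m -> R^o) (L alpha beta s mu : R) (x y : nat -> 'rV[R]_m)
    (xm1 xstar : 'rV[R]_m) :
  (forall z, differentiable g z) -> 0 < L -> lipschitz_gradient L g ->
  0 < alpha -> 0 < beta -> beta < 1 -> 0 < s -> s * L / 2 < 1 - beta ->
  (forall n : nat,
     y n = x n + (beta * n%:R / (n%:R + alpha)) *: (x n - shifted xm1 x n)) ->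
  (forall n : nat, x n.+1 = y n - s *: gradient g (y n)) ->
  0 < mu -> strongly_convex_with mu g -> minimizer g xstar ->
  exists (Q a : R) (k : nat), [/\ 0 < Q, Q < 1, 0 < a &
    forall n : nat, (k <= n)%N -> g (y n) - g xstar <= a * Q ^+ n].
Proof.
move=> dg L_gt0 lip alpha_gt0 beta_gt0 beta_lt1 s_gt0 tau_lt yE xE mu_gt0 sc xs_min.
pose eps := (1 - beta - s * L / 2) / 2.
have eps_gt0 : 0 < eps by rewrite /eps; lra.
pose delta := beta * (1 - beta / 2 - s * L / 2) + eps.
have delta_gt0 : 0 < delta.
  by rewrite /delta addr_gt0// mulr_gt0//; lra.
have eta_gt0 : 0 < eps / 12 by rewrite divr_gt0.
have [k near_beta] := inertial_coefficient_near alpha_gt0 beta_gt0 beta_lt1 eta_gt0.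
pose b n : R := beta * n%:R / (n%:R + alpha).
pose d n := x n - shifted xm1 x n.
pose P n := dot (d n) (d n) + dot (d n.+1) (d n.+1).
pose E n : R := g (y n) - g xstar + delta / s * dot (d n) (d n).
pose c := eps / (2 * s).
(* The first term combines [polyak_lojasiewicz] with [gradient_dot_le]; the second bounds the
   kinetic part of [E]. *)
pose K := 2 / (mu * s ^+ 2) + delta / s.
have c_gt0 : 0 < c by rewrite /c divr_gt0 // mulr_gt0.
have K_gt0 : 0 < K.
  by rewrite /K addr_gt0 // divr_gt0 // mulr_gt0 // exprn_gt0.
have P_ge0 n : 0 <= P n by rewrite addr_ge0 ?dot_ge0.
have E_decrease n : (k <= n)%N -> E n.+1 <= E n - c * P n.
  move=> kn.
  have := energy_decrease dg L_gt0 lip beta_gt0 beta_lt1 s_gt0 tau_lt erefl erefl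
    (near_beta n kn) (near_beta n.+1 (leqW kn)) (yE n) (xE n) (yE n.+1).
  rewrite -/eps -/delta -/(d n) -/(d n.+1) /E /c /P.
  move: (dot (d n) _) (dot (d n.+1) _) => p q.
  by move: (g (y n.+1)) (g (y n)) (g xstar) => a' a a0; lra.
have E_le n : E n <= K * P n.
  have b01 : 0 <= b n <= 1.
    have na_gt0 : 0 < n%:R + alpha by rewrite ltr_wpDl.
    rewrite /b divr_ge0 ?mulr_ge0 ?(ltW beta_gt0) ?(ltW na_gt0)//=.
    rewrite ler_pdivrMr// mul1r.
    by rewrite (le_trans (ler_piMl _ (ltW beta_lt1)))// lerDl ltW.
  have sG : s *: gradient g (y n) = b n *: d n - d n.+1.
    rewrite {2}/d /= xE {2}yE -/(d n) -/(b n).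
    by rewrite addrAC [x n + _]addrC addrK opprB addrC subrK.
  have := gradient_dot_le b01 sG; rewrite -/(P n).
  have := polyak_lojasiewicz dg L_gt0 lip mu_gt0 sc (y n) xstar.
  move: (gradient g (y n)) {sG} => G pl GP.
  have {}pl : g (y n) - g xstar <= 2 / (mu * s ^+ 2) * P n.
    rewrite (le_trans pl)// ler_pdivrMr//.
    have -> : 2 / (mu * s ^+ 2) * P n * mu = 2 * P n / s ^+ 2.
      by field; rewrite !gt_eqF.
    by rewrite ler_pdivlMr ?exprn_gt0// mulrC.
  have dP : delta / s * dot (d n) (d n) <= delta / s * P n.
    rewrite ler_wpM2l ?divr_ge0 ?(ltW s_gt0) ?(ltW delta_gt0)//.
    by rewrite lerDl dot_ge0.
  by rewrite /K mulrDl; exact: lerD.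
pose Q := K / (K + c).
have Kc_gt0 : 0 < K + c by rewrite addr_gt0.
have Q_gt0 : 0 < Q by rewrite /Q divr_gt0.
have Q_lt1 : Q < 1 by rewrite /Q ltr_pdivrMr // mul1r ltrDl.
have E_contract n : (k <= n)%N -> E n.+1 <= Q * E n.
  by move=> /E_decrease E_dec; apply: contraction_of_decrease E_dec _ _.
have E_geometric := geometric_decay Q_gt0 E_contract.
have gap_le n : g (y n) - g xstar <= E n.
  by rewrite lerDl mulr_ge0 ?dot_ge0// divr_ge0 ?ltW.
(* [E k] may vanish; adding 1 keeps the constant strictly positive. *)
exists Q, (E k / Q ^+ k + 1), k; split=> //.
  rewrite ltr_wpDl// divr_ge0 ?exprn_ge0 ?(ltW Q_gt0)//.
  by rewrite (le_trans _ (gap_le k))// subr_ge0.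
move=> n kn; rewrite (le_trans (gap_le n))// (le_trans (E_geometric n kn))//.
by rewrite ler_pM2r ?exprn_gt0// lerDl.
Qed.

Unset Implicit Arguments.

Theorem theorem23 (R : realType) (m : nat) (g : 'rV[R]_m -> R^o)
    (Lg alpha beta s : R) (x0 xm1 : 'rV[R]_m) (x y : nat -> 'rV[R]_m)
    (xstar : 'rV[R]_m)
    (g_diff : forall z : 'rV[R]_m, differentiable g z)
    (g_lip : lipschitz_gradient Lg g)
    (alpha_gt0 : 0 < alpha)
    (beta_gt0 : 0 < beta) (beta_lt1 : beta < 1)
    (s_gt0 : 0 < s)
    (* when Lg = 0 the bound 2 (1 - beta) / Lg is +oo *)
    (s_lt : 0 < Lg -> s < 2 * (1 - beta) / Lg)
    (x_init : x 0%N = x0)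
    (y_def : forall n : nat,
       y n = x n + (beta * n%:R / (n%:R + alpha)) *: (x n - shifted xm1 x n))
    (x_step : forall n : nat, x n.+1 = y n - s *: gradient g (y n))
    (g_sc : strongly_convex g)
    (xstar_min : unique (minimizer g) xstar) :
  exists (Q a1 a2 a3 a4 : R) (kbar : nat),
    (0 <= Q /\ Q < 1) /\
    (0 < a1 /\ 0 < a2 /\ 0 < a3 /\ 0 < a4) /\
    forall n : nat, (kbar <= n)%N ->
      g (y n) - g xstar <= a1 * Q ^+ n /\
      g (x n) - g xstar <= a2 * Q ^+ n /\
      enorm (x n - xstar) <= a3 * Q `^ (n%:R / 2) /\
      enorm (y n - xstar) <= a4 * Q `^ (n%:R / 2).
Proof.
have [L [L_gt0 lip tau_lt]] :=
  positive_lipschitz_constant g_lip beta_lt1 s_gt0 s_lt.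
have [mu mu_gt0 sc] := g_sc; have [xs_min _] := xstar_min.
have [Q [a [k [Q_gt0 Q_lt1 a_gt0 gap_y]]]] :=
  inertial_energy_geometric g_diff L_gt0 lip alpha_gt0 beta_gt0 beta_lt1 s_gt0
    tau_lt y_def x_step mu_gt0 sc xs_min.
have aQ_gt0 : 0 < a / Q by rewrite divr_gt0.
have tau_le1 : s * L / 2 <= 1 by lra.
(* The value at [x n.+1] is bounded by that at [y n]; the index shift costs the factor [1 / Q] and
   moves the threshold to [k.+1]. *)
exists Q, a, (a / Q), (Num.sqrt (4 * (a / Q) / mu)), (Num.sqrt (4 * a / mu)), k.+1.
split; first by rewrite ltW.
split.
  by do 2!split=> //; split; rewrite sqrtr_gt0 divr_gt0 // mulr_gt0.
case=> // n; rewrite ltnS => kn.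
have gap_x : g (x n.+1) - g xstar <= a / Q * Q ^+ n.+1.
  rewrite exprS mulrA divfK ?gt_eqF// (le_trans _ (gap_y n kn))// lerD2r x_step.
  exact: gradient_step_decrease g_diff L_gt0 lip s_gt0 tau_le1.
have gap_y' := gap_y _ (leqW kn).
do 2!split=> //.
have growth z := quadratic_growth z sc xs_min.
by split; apply: enorm_le_powR => //; rewrite ?(ltW Q_gt0)// (le_trans (growth _)).
Qed.
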